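(* Let $u\ge 1$, $m=2u$, $n=2^m-1$, $r=2^u+1$, $\alpha$ a primitive element of $\mathbb{F}_{2^m}$; for $j=0,\dots,n-1$ write $\alpha^j=\gamma_{j1}+\gamma_{j2}\alpha$ with $\gamma_{j1},\gamma_{j2}\in\mathbb{F}_{2^u}$ and set $S(\mathbf{v})=\sum_{j\in\operatorname{Supp}(\mathbf{v})}\gamma_{j1}\gamma_{j2}$ for $\mathbf{v}\in\mathbb{F}_2^n$. Let $H_m$ (resp. $E_m$) be the $m\times n$ binary matrix whose $j$-th column is the binary representation of $\alpha^j$ (resp. $\alpha^{jr}$) with respect to a fixed $\mathbb{F}_2$-basis of $\mathbb{F}_{2^m}$, and $C^{(u)}=\{\mathbf{v}: H_m\mathbf{v}^T=0,\ E_m\mathbf{v}^T=0\}$. Let $i\in\{0,\dots,u\}$, let $\mathbf{v}_1,\dots,\mathbf{v}_{u-i}\in\mathbb{F}_2^n$ satisfy $H_m\mathbf{v}_k^T=0$ with $S(\mathbf{v}_1),\dots,S(\mathbf{v}_{u-i})$ linearly independent over $\mathbb{F}_2$, let $C^{(i)}$ be the binary linear code generated by $C^{(u)}$ and $\mathbf{v}_1,\dots,\mathbf{v}_{u-i}$, and let $C^{(i)*}$ (length $2^m$) be its extension by an overall parity-check coordinate. Identify the coordinates of $C^{(i)*}$ with the elements of $\mathbb{F}_{2^m}\cong\mathbb{F}_2^m$ (the parity coordinate with $0$, coordinate $j$ of $C^{(i)}$ with $\alpha^j$). Then $\operatorname{Aut}(C^{(i)*})$ is the semidirect product $\operatorname{Aut}(C^{(i)})\ltimes\mathbb{F}_2^m$,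 where the normal subgroup $\mathbb{F}_2^m$ consists of the translations $x\mapsto x+w$ ($w\in\mathbb{F}_2^m$) of coordinates and $\operatorname{Aut}(C^{(i)})$ is identified with the stabilizer of the parity coordinate. Moreover, if $C^{(i)}$ is completely transitive, then $C^{(i)*}$ is completely transitive.
   Context: $\operatorname{Aut}(C)$ is the group of coordinate permutations mapping the code $C$ onto itself; it acts on cosets by $\pi(C+\mathbf{v})=C+\pi(\mathbf{v})$. A binary linear code with covering radius $\rho$ (maximum Hamming distance from a vector to the code) is completely transitive if $\operatorname{Aut}(C)$ has exactly $\rho+1$ orbits on the cosets of $C$. *)

(* Defs.v *)
From HB Require Import structures.
From mathcomp Require Import all_boot all_order all_fingroup all_algebra all_field.

Set Implicit Arguments.
Unset Strict Implicit.
Unset Printing Implicit Defensive.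

Import GRing.Theory.
Local Open Scope ring_scope.

Section BinaryCodes.

Variable n : nat.
Implicit Types (C : {vspace 'rV['F_2]_n}) (v w : 'rV['F_2]_n) (s : 'S_n).

(* Entry j of v is moved to position s j; the inverse makes this a right action
   for the product of 'S_n. *)
Definition permv v s : 'rV['F_2]_n := col_perm (s^-1)%g v.

Lemma permv_is_action : is_action [set: 'S_n] permv.
Proof.
apply: is_total_action => [v|v s t].
  by rewrite /permv invg1 col_perm1.
by rewrite /permv invMg col_permM.
Qed.
Definition permv_action := Action permv_is_action.

Definition Aut_code C : {set 'S_n} :=
  [set s | [set permv v s | v in C] == [set v in C]].

Lemma Aut_codeE C : Aut_code C = 'N([set v in C] | permv_action)%g.
Proof.
apply/setP=> s; rewrite inE; apply/eqP/idP => [e|/astabs_setact].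
  rewrite !inE /=; apply/subsetP=> v; rewrite !inE => vC.
  have : permv v s \in [set permv v s | v in C] by apply/imsetP; exists v.
  by rewrite e inE.
rewrite /setact /= => e; rewrite -[RHS]e.
by apply/setP=> v; apply/imsetP/imsetP => -[w wC ->]; exists w; rewrite // inE in wC *.
Qed.

Lemma Aut_code_group_set C : group_set (Aut_code C).
Proof. by rewrite Aut_codeE groupP. Qed.
Canonical Aut_code_group C := Group (Aut_code_group_set C).

Definition code_coset C v : {set 'rV['F_2]_n} := [set v + c | c in C].
Definition code_cosets C : {set {set 'rV['F_2]_n}} :=
  [set code_coset C v | v : 'rV['F_2]_n].

Lemma permv_coset C v s : s \in Aut_code C ->
  (permv_action^* (code_coset C v) s)%act = code_coset C (permv v s).
Proof.
rewrite inE => /eqP e; rewrite /setact /code_coset /=.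
have pD x y : permv (x + y) s = permv x s + permv y s.
  by apply/rowP=> j; rewrite !mxE.
apply/setP=> x; apply/imsetP/imsetP => [[_ /imsetP[c cC ->] ->]|[c cC ->]].
  exists (permv c s); last exact: pD.
  have : permv c s \in [set permv v s | v in C] by apply/imsetP; exists c.
  by rewrite e inE.
have : c \in [set permv v s | v in C] by rewrite e inE.
case/imsetP=> d dC ->; exists (v + d); last exact/esym/pD.
by apply/imsetP; exists d.
Qed.

Definition hamming_dist v w : nat := #|[set j | v 0 j != w 0 j]|.

(* n bounds every Hamming distance, so it is a neutral default for the minimum. *)
Definition dist_code C v : nat := \big[minn/n]_(c in C) hamming_dist v c.

Definition covering_radius C : nat := \max_(v : 'rV['F_2]_n) dist_code C v.

Definition completely_transitive C : Prop :=
  #|orbit (permv_action^*) (Aut_code C) @: code_cosets C|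
    = (covering_radius C).+1.

(* Right multiplication by this matrix maps v to (\sum_j v_j, v). *)
Definition parity_mx : 'M['F_2]_(n, n.+1) :=
  row_mx (const_mx 1 : 'M_(n, 1)) 1%:M.

Definition extended_code C : {vspace 'rV['F_2]_n.+1} :=
  (linfun (mulmxr parity_mx) @: C)%VS.

Lemma extended_codeP C (w : 'rV['F_2]_n.+1) :
  reflect (exists2 v, v \in C &
             w 0 ord0 = \sum_j v 0 j /\ forall j, w 0 (lift ord0 j) = v 0 j)
          (w \in extended_code C).
Proof.
have pE v : (v *m parity_mx) 0 ord0 = \sum_j v 0 j
         /\ forall j, (v *m parity_mx) 0 (lift ord0 j) = v 0 j.
  have -> : v *m parity_mx = row_mx (v *m (const_mx 1 : 'M_(n, 1))) v.
    by have := mul_mx_row v (const_mx 1 : 'M_(n, 1)) 1%:M; rewrite mulmx1.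
  split=> [|j].
    have -> : @ord0 n = @lshift 1 n ord0 by apply/val_inj.
    rewrite (@row_mxEl _ 1 1 n) mxE.
    by apply: eq_bigr => j _; rewrite mxE mulr1.
  have -> : lift ord0 j = @rshift 1 n j by apply/val_inj.
  by rewrite (@row_mxEr _ 1 1 n).
apply: (iffP memv_imgP) => -[v vC].
  by rewrite lfunE /= => ->; exists v.
case=> w0 wS; exists v => //; rewrite lfunE /=; apply/rowP=> k.
have [e0 eS] := pE v.
by case: (unliftP ord0 k) => [j ->|->]; rewrite ?eS ?e0.
Qed.

End BinaryCodes.

Section Construction.

Variables (m n : nat) (F : fieldExtType 'F_2).
Variables (b : m.-tuple F) (alpha : F).

Definition Hmx : 'M['F_2]_(m, n) :=
  \matrix_(k < m, j < n) coord b k (alpha ^+ j).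

Definition Emx (r : nat) : 'M['F_2]_(m, n) :=
  \matrix_(k < m, j < n) coord b k (alpha ^+ (j * r)).

Definition check_code (M : 'M['F_2]_(m, n)) : {vspace 'rV['F_2]_n} :=
  lker (linfun (mulmx M \o trmx)).

Lemma mem_check_code M (v : 'rV['F_2]_n) :
  (v \in check_code M) = (M *m v^T == 0).
Proof. by rewrite memv_ker lfunE. Qed.

Definition code_u (r : nat) : {vspace 'rV['F_2]_n} :=
  (check_code Hmx :&: check_code (Emx r))%VS.

Definition Ssum (g1 g2 : 'I_n -> F) (v : 'rV['F_2]_n) : F :=
  \sum_(j < n | v 0 j != 0) g1 j * g2 j.

Definition code_gen (r : nat) (vs : seq 'rV['F_2]_n) : {vspace 'rV['F_2]_n} :=
  (code_u r + <<vs>>)%VS.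

Definition coord_point (k : 'I_n.+1) : F :=
  if unlift ord0 k is Some j then alpha ^+ j else 0.

(* finvect_type F is F itself, equipped with its finType structure. *)
Definition translations : {set 'S_n.+1} :=
  [set s : 'S_n.+1 | [exists w : finvect_type F,
     [forall k, coord_point (s k) == coord_point k + (w : F)]]].

End Construction.

(* Main.v *)
(** Let q = 2^u and N x = x^(q+1), the norm of F over its subfield of order q.
    The extended code lies between the vectors w with
      \sum w_x = 0, \sum w_x x = 0, \sum w_x N x = 0
    and those satisfying the first two conditions.  As
      N (x + y) = N x + N y + (x^q y + x y^q),
    translating w by y leaves \sum w_x N x unchanged when w is a codeword, so
    translations are automorphisms, and the automorphism group is transitive.

    If an automorphism s fixes 0, every coordinate functional of s annihilates
    the vectors with zero sums above, hence s x = lambda x + mu (N x) with lambda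
    and mu linear.  If mu did not vanish on norms, some coordinate of s would be
    a bent function; but coordinates of a bijection are balanced.  So s is linear
    and normalises the translations.

    Every distance up to the covering radius occurs, so complete transitivity
    means that cosets at equal distance from the code lie in one orbit.  By
    transitivity on coordinates, a coset of the extended code at distance d > 0
    can be moved so that it has a leader of weight d with the parity coordinate in
    its support; deleting that coordinate gives a coset leader of weight d - 1 of
    the original code, where cosets at equal distance are conjugate. *)

Require Import Defs.
From HB Require Import structures.
From mathcomp Require Import all_boot all_order all_fingroup all_algebra all_field.

Set Implicit Arguments.
Unset Strict Implicit.
Unset Printing Implicit Defensive.

Import GRing.Theory.
Local Open Scope ring_scope.

(** * Distance to a code and orbits on cosets *)

Lemma F2_neq0 (a : 'F_2) : a != 0 -> a = 1.
Proof. by move: a; do 2?case=> //; move=> [|[|k]] lt_k // _; apply/val_inj. Qed.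

Lemma F2_addrr (a : 'F_2) : a + a = 0.
Proof. by have := pchar_Fp (isT : prime 2) => /addrr_pchar2 ->. Qed.

Lemma F2_oppr (a : 'F_2) : - a = a.
Proof. by apply/eqP; rewrite -subr_eq0 -opprD F2_addrr oppr0. Qed.

Lemma F2_neq0_natr (a : 'F_2) : (a != 0)%:R = a.
Proof. by case: (altP (a =P 0)) => [->|/F2_neq0->]. Qed.

Section ImsetFactor.

Variables (T A B : finType) (f : T -> A) (g : T -> B).
Hypothesis f_g : forall x y, f x = f y -> g x = g y.

Let h (b0 : B) a := odflt b0 (omap g [pick x | f x == a]).

Let hE b0 x : h b0 (f x) = g x.
Proof.
rewrite /h; case: pickP => [y /eqP/f_g //|/(_ x)]; by rewrite eqxx.
Qed.

Let imset_h b0 : [set h b0 a | a in f @: T] = g @: T.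
Proof. by rewrite -imset_comp; apply: eq_imset => x /=; rewrite hE. Qed.

Lemma card_imset_factorP :
  reflect (forall x y, g x = g y -> f x = f y) (#|f @: T| == #|g @: T|).
Proof.
apply: (iffP idP) => [eq_fg x y gxy | g_f].
  move: eq_fg; rewrite -(imset_h (g x)) eq_sym => /imset_injP; apply.
  - exact: imset_f.
  - exact: imset_f.
  - by rewrite !hE.
have [x _|T0] := pickP T; last first.
  suff E (S : finType) (k : T -> S) : k @: T = set0 by rewrite !E !cards0.
  by apply/setP=> z; rewrite inE; apply/imsetP=> -[y]; have := T0 y; rewrite !inE.
rewrite -(imset_h (g x)) eq_sym; apply/imset_injP.
by move=> _ _ /imsetP[y _ ->] /imsetP[z _ ->]; rewrite !hE => /g_f.
Qed.

End ImsetFactor.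

Section Codes.

Variable n : nat.
Implicit Types (C : {vspace 'rV['F_2]_n}) (v w : 'rV['F_2]_n) (s : 'S_n).

Definition wt v : nat := #|[set j | v 0 j != 0]|.

Lemma hamming_distE v w : hamming_dist v w = wt (v - w).
Proof. by apply: eq_card => j; rewrite !inE !mxE subr_eq0. Qed.

Lemma wt_le v : (wt v <= n)%N.
Proof. by have := max_card [set j | v 0 j != 0]; rewrite card_ord. Qed.

Lemma wtE v : wt v = (\sum_j (v 0%R j != 0%R))%N.
Proof. by rewrite /wt -sum1dep_card big_mkcond. Qed.

Lemma wtD v w : (wt (v + w) <= wt v + wt w)%N.
Proof.
apply: leq_trans (leq_card_setU _ _); apply/subset_leq_card/subsetP=> j.
rewrite !inE !mxE -negb_and; apply: contra => /andP[/eqP-> /eqP->].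
by rewrite addr0.
Qed.

Lemma wt_permv v s : wt (permv v s) = wt v.
Proof.
rewrite /wt -[RHS](card_imset _ (@perm_inj _ s)).
apply: eq_card => j; rewrite inE mxE; apply/idP/imsetP=> [vj|[k]].
  by exists (s^-1%g j); rewrite ?inE // permKV.
by rewrite inE => vk ->; rewrite permK.
Qed.

Lemma sum_wt v : \sum_j v 0 j = (wt v)%:R.
Proof.
by rewrite wtE natr_sum; apply: eq_bigr => j _; rewrite F2_neq0_natr.
Qed.

Lemma dist_code_le C v c : c \in C -> (dist_code C v <= wt (v - c))%N.
Proof.
move=> cC; rewrite -hamming_distE.
exact: (@Order.TotalTheory.bigmin_le_cond _ nat _ n c (mem C) (hamming_dist v)).
Qed.

Lemma dist_code_attained C v :
  exists2 c, c \in C & wt (v - c) = dist_code C v.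
Proof.
rewrite /dist_code; pose P d := (d = n \/ exists2 c, c \in C & wt (v - c) = d).
have: P (\big[minn/n]_(c in C) hamming_dist v c).
  elim/big_ind: _ => [|x y Px Py|c cC]; first by left.
    by rewrite /minn; case: ifP.
  by right; exists c; rewrite ?hamming_distE.
(* If the minimum is the default [n], the zero codeword attains it: its distance to [v] is at least
   the minimum [n] and at most the length [n]. *)
case=> // e; exists 0; rewrite ?mem0v //.
apply/eqP; rewrite eqn_leq {1}e wt_le -hamming_distE.
have := @dist_code_le C v 0 (mem0v _).
by rewrite /dist_code e -hamming_distE.
Qed.

Lemma dist_code_ge C v d :
  (forall c, c \in C -> (d <= wt (v - c))%N) -> (d <= dist_code C v)%N.
Proof. by have [c cC <-] := dist_code_attained C v; apply. Qed.

Lemma dist_code_shift C v c : c \in C -> dist_code C (v + c) = dist_code C v.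
Proof.
move=> cC; apply/eqP; rewrite eqn_leq; apply/andP; split.
  apply: dist_code_ge => d dC.
  by rewrite -[v - d](addrKA c) opprD addrA addrAC -addrA -opprD
             dist_code_le ?rpredD.
apply: dist_code_ge => d dC; have := @dist_code_le C v (d - c).
by rewrite opprB addrA addrAC => -> //; rewrite rpredB.
Qed.

Lemma dist_code_subadd C v w : (dist_code C (v + w) <= dist_code C v + wt w)%N.
Proof.
have [c cC <-] := dist_code_attained C v.
by apply: leq_trans (dist_code_le _ cC) _; rewrite addrAC wtD.
Qed.

Lemma mem_Aut_code C s :
  reflect (forall v, v \in C -> permv v s \in C) (s \in Aut_code C).
Proof.
rewrite Aut_codeE !inE /=; apply: (iffP subsetP) => sC v.
  by move=> vC; have := sC v; rewrite !inE; apply.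
by rewrite !inE; apply: sC.
Qed.

Lemma permvB v w s : permv (v - w) s = permv v s - permv w s.
Proof. by apply/rowP=> j; rewrite !mxE. Qed.

Lemma permv1 v : permv v 1%g = v.
Proof. by rewrite /permv invg1 col_perm1. Qed.

Lemma permvM v s t : permv v (s * t)%g = permv (permv v s) t.
Proof. by rewrite /permv invMg col_permM. Qed.

Lemma permvK v s : permv (permv v s) s^-1%g = v.
Proof. by rewrite -permvM mulgV permv1. Qed.

Lemma dist_code_permv C v s :
  s \in Aut_code C -> dist_code C (permv v s) = dist_code C v.
Proof.
(* One inequality suffices, since applying it to [s^-1] gives the other. *)
suff le_d w t : t \in Aut_code C -> (dist_code C (permv w t) <= dist_code C w)%N.
  move=> sC; apply/eqP; rewrite eqn_leq le_d //=.
  by rewrite -{1}(permvK v s) le_d ?groupV.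
move=> /mem_Aut_code tC; apply: dist_code_ge => c cC.
by rewrite -(wt_permv _ t) permvB dist_code_le ?tC.
Qed.

Lemma mem_code_coset C v w : (w \in code_coset C v) = (w - v \in C).
Proof.
apply/imsetP/idP => [[c cC ->]|wvC]; first by rewrite addrC addKr.
by exists (w - v); rewrite // addrC subrK.
Qed.

Lemma code_coset_eq C v w : v - w \in C -> code_coset C v = code_coset C w.
Proof.
move=> vwC; apply/setP=> x; rewrite !mem_code_coset.
by rewrite -(rpredDr _ vwC) addrA subrK.
Qed.

Definition coset_orbit C v :=
  orbit (permv_action n)^* (Aut_code C) (code_coset C v).

Lemma coset_orbit_eqP C v w :
  reflect (exists2 s, s \in Aut_code C & permv v s - w \in C)
          (coset_orbit C v == coset_orbit C w).
Proof.
rewrite eq_sym; apply: (iffP eqP) => [/orbit_eqP/orbitP[s sC]|[s sC svw]].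
  rewrite permv_coset // => e; exists s => //.
  by rewrite -mem_code_coset -e mem_code_coset subrr mem0v.
apply/orbit_eqP/orbitP; exists s => //.
by rewrite permv_coset //; apply: code_coset_eq.
Qed.

Lemma dist_code_le_radius C v : (dist_code C v <= covering_radius C)%N.
Proof. exact: (leq_bigmax v). Qed.

Lemma covering_radius_attained C : exists v, dist_code C v = covering_radius C.
Proof.
have [|v ev] := @eq_bigmax _ (dist_code C); last by exists v.
by apply/card_gt0P; exists 0.
Qed.

(* Zeroing one coordinate of a coset leader lowers the distance by exactly one. *)
Lemma dist_code_pred C v d :
  dist_code C v = d.+1 -> exists w, dist_code C w = d.
Proof.
have [c cC ec] := dist_code_attained C v => ed.
have [j] : exists j, j \in [set j | (v - c) 0 j != 0].
  by apply/card_gt0P; rewrite -/(wt _) ec ed.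
rewrite inE => vcj; pose e : 'rV['F_2]_n := delta_mx 0 j.
have wte : wt e = 1%N.
  rewrite /wt -[RHS](cards1 j); apply: eq_card => k; rewrite !inE mxE /=.
  by case: (k == j).
exists (v - c - e); apply/eqP; rewrite eqn_leq; apply/andP; split.
  apply: leq_trans (dist_code_le _ (mem0v C)) _; rewrite subr0.
  rewrite -ltnS -ed -ec /wt (cardsD1 j [set j | (v - c) 0 j != 0]) inE vcj add1n.
  rewrite ltnS; apply/subset_leq_card/subsetP=> k; rewrite !inE.
  rewrite [(v - c - e) 0 k]mxE [(- e) 0 k]mxE [e 0 k]mxE /=.
  case: (altP (k =P j)) => [->|_]; last by rewrite subr0 => ->.
  by rewrite (F2_neq0 vcj) subrr eqxx.
have := dist_code_subadd C (v - c - e) e.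
by rewrite wte addn1 subrK dist_code_shift ?rpredN // ed ltnS.
Qed.

Lemma dist_code_surj C d : (d <= covering_radius C)%N ->
  exists v, dist_code C v = d.
Proof.
(* Induction on the gap below the covering radius, each step descending by [dist_code_pred]. *)
move=> le_d; rewrite -(subKn le_d); elim: (_ - d)%N (leq_subr d (covering_radius C)).
  by rewrite subn0 => _; apply: covering_radius_attained.
move=> k IHk lt_k; have [v ev] := IHk (ltnW lt_k).
by apply: (@dist_code_pred C v); rewrite ev subnSK.
Qed.

(** Distance is constant on orbits and takes all values from 0 to the covering radius, so the orbit
    count is as required exactly when distance separates orbits. *)
Lemma completely_transitiveP C :
  completely_transitive C <->
  (forall v w, dist_code C v = dist_code C w ->
     exists2 s, s \in Aut_code C & permv v s - w \in C).
Proof.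
pose g v : 'I_(covering_radius C).+1 := inord (dist_code C v).
have gE v : g v = dist_code C v :> nat.
  by rewrite inordK // ltnS dist_code_le_radius.
have -> : completely_transitive C =
    (#|[set coset_orbit C v | v : 'rV['F_2]_n]| = #|[set g v | v : 'rV['F_2]_n]|).
  rewrite /completely_transitive /code_cosets -imset_comp.
  suff -> : [set g v | v : 'rV['F_2]_n] = setT by rewrite cardsT card_ord.
  apply/setP=> d; rewrite inE; apply/imsetP.
  have [v ev] := dist_code_surj (leq_ord d).
  by exists v => //; apply/val_inj; rewrite /= gE.
have orb_g v w : coset_orbit C v = coset_orbit C w -> g v = g w.
  move/eqP/coset_orbit_eqP=> [s sC svw]; apply/val_inj; rewrite /= !gE.
  by rewrite -(dist_code_permv v sC) -(dist_code_shift w svw) addrC subrK.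
split=> [/eqP/(card_imset_factorP orb_g) g_orb v w dvw | H].
  by apply/coset_orbit_eqP/eqP/g_orb/val_inj; rewrite /= !gE.
apply/eqP/(card_imset_factorP orb_g) => v w /(congr1 val); rewrite /= !gE.
by move/H/coset_orbit_eqP/eqP.
Qed.

End Codes.

(** * Parity extension *)

Section Extension.

Variable n : nat.
Implicit Types (C : {vspace 'rV['F_2]_n}) (v : 'rV['F_2]_n) (w : 'rV['F_2]_n.+1).

Definition ext_tail w : 'rV['F_2]_n := \row_j w 0 (lift ord0 j).

Definition ext_cons (p : 'F_2) v : 'rV['F_2]_n.+1 :=
  \row_k oapp (v 0) p (unlift ord0 k).

Lemma ext_cons0 p v : ext_cons p v 0 ord0 = p.
Proof. by rewrite mxE unlift_none. Qed.

Lemma ext_consS p v j : ext_cons p v 0 (lift ord0 j) = v 0 j.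
Proof. by rewrite mxE liftK. Qed.

Lemma ext_consK p v : ext_tail (ext_cons p v) = v.
Proof. by apply/rowP=> j; rewrite mxE ext_consS. Qed.

Lemma ext_tailB w w' : ext_tail (w - w') = ext_tail w - ext_tail w'.
Proof. by apply/rowP=> j; rewrite !mxE. Qed.

Lemma sum_ext w : \sum_k w 0 k = w 0 ord0 + \sum_j ext_tail w 0 j.
Proof.
by rewrite big_ord_recl; congr (_ + _); apply: eq_bigr => j _; rewrite mxE.
Qed.

Lemma mem_extended_code C w :
  (w \in extended_code C) = (\sum_k w 0 k == 0) && (ext_tail w \in C).
Proof.
rewrite sum_ext addr_eq0 -sumrN.
under eq_bigr do rewrite F2_oppr.
apply/extended_codeP/andP => [[v vC [w0 wS]]|[/eqP w0 wC]].
  have -> : ext_tail w = v by apply/rowP=> j; rewrite mxE.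
  by rewrite w0 eqxx.
by exists (ext_tail w) => //; split=> // j; rewrite mxE.
Qed.

Lemma mem_ext_cons C p v :
  (ext_cons p v \in extended_code C) = (p == \sum_j v 0 j) && (v \in C).
Proof.
by rewrite mem_extended_code sum_ext ext_consK ext_cons0 -[in RHS]subr_eq0
  [in RHS]F2_oppr.
Qed.

Lemma wt_ext w : wt w = ((w 0%R ord0 != 0%R) + wt (ext_tail w))%N.
Proof.
rewrite !wtE big_ord_recl; congr (_ + _)%N.
by apply: eq_bigr => j _; rewrite mxE.
Qed.

Lemma sum_permv w (s : 'S_n.+1) : \sum_k permv w s 0 k = \sum_k w 0 k.
Proof.
rewrite (reindex_inj (@perm_inj _ s)) /=.
by apply: eq_bigr => k _; rewrite mxE permK.
Qed.

Lemma ext_tail_lift_perm w (s : 'S_n) :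
  ext_tail (permv w (lift_perm ord0 ord0 s)) = permv (ext_tail w) s.
Proof. by apply/rowP=> j; rewrite !mxE lift_permV lift_perm_lift. Qed.

Lemma lift_perm_Aut_code C (s : 'S_n) :
  (lift_perm ord0 ord0 s \in Aut_code (extended_code C)) = (s \in Aut_code C).
Proof.
apply/mem_Aut_code/mem_Aut_code => sC v.
  move=> vC; have := sC (ext_cons (\sum_j v 0 j) v).
  rewrite mem_ext_cons eqxx mem_extended_code ext_tail_lift_perm ext_consK.
  by move/(_ vC)/andP=> [].
rewrite !mem_extended_code sum_permv ext_tail_lift_perm => /andP[-> /sC].
by [].
Qed.

Lemma lift_perm_ord0P (t : 'S_n.+1) : t ord0 = ord0 ->
  exists s, t = lift_perm ord0 ord0 s.
Proof.
move=> t0; have tS j : t (lift ord0 j) != ord0.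
  by rewrite -{2}t0 (inj_eq perm_inj) eq_sym neq_lift.
(* The default [j] is never reached: by [tS], [t] sends no [lift ord0 j] to [ord0]. *)
pose f j := odflt j (unlift ord0 (t (lift ord0 j))).
have fE j : lift ord0 (f j) = t (lift ord0 j).
  by rewrite /f; case: unliftP (tS j) => [k ->|->]; rewrite ?eqxx.
have f_inj : injective f.
  by move=> j k /(congr1 (lift ord0)); rewrite !fE => /perm_inj/lift_inj.
exists (perm f_inj); apply/permP=> k; case: (unliftP ord0 k) => [j|] ->.
  by rewrite lift_perm_lift permE fE.
by rewrite lift_perm_id.
Qed.

Lemma misom_lift_perm C :
  misom (Aut_code C) ('C_(Aut_code (extended_code C))[ord0 | 'P])%g
        (lift_perm ord0 ord0).
Proof.
have liftM : {morph @lift_perm n ord0 ord0 : s t / (s * t)%g}.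
  by move=> s t; rewrite lift_permM.
have lift_inj1 : injective (@lift_perm n ord0 ord0).
  move=> s t /permP est; apply/permP=> j.
  by have := est (lift ord0 j); rewrite !lift_perm_lift => /lift_inj.
(* [misom] compares images of nonidentity elements, so injectivity of the lift is used to keep
   identities apart. *)
apply/andP; split; first by apply/morphicP=> s t _ _; apply: liftM.
apply/eqP/setP=> t; rewrite in_setD1 in_setI; apply/imsetP/and3P.
  move=> [s]; rewrite in_setD1 => /andP[s1 sC] ->; split.
  - by rewrite -(lift_perm1 ord0) (inj_eq lift_inj1).
  - by rewrite lift_perm_Aut_code.
  - by apply/astab1P; rewrite /= /aperm lift_perm_id.
move=> [t1 tC /astab1P t0]; have [s es] := lift_perm_ord0P t0.
exists s => //; rewrite in_setD1; apply/andP; split.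
  by apply: contraNneq t1 => s1; rewrite es s1 lift_perm1.
by rewrite -lift_perm_Aut_code -es.
Qed.

Lemma ext_leader C w d :
  (forall k, exists2 s, s \in Aut_code (extended_code C) & s k = ord0) ->
  dist_code (extended_code C) w = d.+1 ->
  exists s w', [/\ s \in Aut_code (extended_code C),
    permv w s - w' \in extended_code C, w' 0 ord0 = 1,
    wt (ext_tail w') = d & dist_code C (ext_tail w') = d].
Proof.
move=> trans ed; have [c cC ec] := dist_code_attained (extended_code C) w.
have [k] : exists k, k \in [set k | (w - c) 0 k != 0].
  by apply/card_gt0P; rewrite -/(wt _) ec ed.
rewrite inE => wck; have [s sC sk] := trans k.
have scC : permv c s \in extended_code C by move/mem_Aut_code: sC; apply.
have w0 : permv (w - c) s 0 ord0 = 1.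
  by rewrite mxE -sk permK (F2_neq0 wck).
have wtw : wt (ext_tail (permv (w - c) s)) = d.
  by apply/eqP; rewrite -eqSS -ed -ec -(wt_permv (w - c) s) [in eqbRHS]wt_ext w0.
exists s, (permv (w - c) s); split=> //.
  by rewrite permvB opprB addrC subrK.
apply/eqP; rewrite eqn_leq; apply/andP; split.
  have := dist_code_le (ext_tail (permv (w - c) s)) (mem0v C).
  by rewrite subr0 wtw.
(* Extending [e] by its parity adds at most one disagreement, in the parity coordinate, and the
   extended word is at distance at least [d.+1]. *)
apply: dist_code_ge => e eC; rewrite -ltnS.
have exC : ext_cons (\sum_j e 0 j) e \in extended_code C.
  by rewrite mem_ext_cons eqxx.
have := dist_code_le (permv (w - c) s) exC.
rewrite dist_code_permv // dist_code_shift ?rpredN // ed => /leq_trans; apply.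
by rewrite wt_ext ext_tailB ext_consK -[leqRHS]add1n leq_add2r leq_b1.
Qed.

Lemma completely_transitive_ext C :
  (forall k, exists2 s, s \in Aut_code (extended_code C) & s k = ord0) ->
  completely_transitive C -> completely_transitive (extended_code C).
Proof.
move=> trans /completely_transitiveP CT; apply/completely_transitiveP=> w w' ew.
case ed: (dist_code (extended_code C) w) => [|d].
  (* At distance 0 both vectors are codewords, so the identity already works. *)
  exists 1%g; first exact: group1.
  have dist0 x : dist_code (extended_code C) x = 0%N -> x \in extended_code C.
    have [c cC <-] := dist_code_attained (extended_code C) x.
    move/cards0_eq/setP=> x0; suff -> : x = c by [].
    apply/rowP=> k; have := x0 k; rewrite !inE !mxE subr_eq0.
    by move/negbFE/eqP.
  by rewrite permv1 rpredB // dist0 // -ew.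
have [s [v [sC swv v0 wtv dv]]] := ext_leader trans ed.
have [s' [v' [sC' swv' v0' wtv' dv']]] := ext_leader trans (etrans (esym ew) ed).
have [t tC tv] := CT _ _ (etrans dv (esym dv')).
pose t' := lift_perm ord0 ord0 t.
have tC' : t' \in Aut_code (extended_code C) by rewrite lift_perm_Aut_code.
(* The parity check of the difference holds because [v] and [v'] both have parity coordinate 1 and
   tails of the same weight [d]. *)
have tvv : permv v t' - v' \in extended_code C.
  rewrite mem_extended_code ext_tailB ext_tail_lift_perm tv andbT.
  rewrite (eq_bigr (fun k => permv v t' 0 k - v' 0 k)); last by move=> k _; rewrite !mxE.
  by rewrite sumrB sum_permv !sum_ext v0 v0' !sum_wt wtv wtv' subrr.
exists (s * t' * s'^-1)%g; first by rewrite !groupM ?groupV.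
rewrite !permvM.
rewrite -{1}(permvK w' s') -permvB.
have: s'^-1%g \in Aut_code (extended_code C) by rewrite groupV.
move/mem_Aut_code; apply.
have -> : permv (permv w s) t' - permv w' s' =
   permv (permv w s - v) t' + (permv v t' - v') - (permv w' s' - v').
  by rewrite permvB opprB !addrA !subrK.
by rewrite rpredB // rpredD //; move/mem_Aut_code: tC'; apply.
Qed.

End Extension.

(** * Bent functions *)

Section SignSums.

(** The nontrivial additive character of F_2, with integer values. *)
Definition sgn2 (a : 'F_2) : int := (-1) ^+ (a != 0).

Lemma sgn2D : {morph sgn2 : a b / a + b >-> a * b}.
Proof.
move=> a b; rewrite /sgn2.
case: (altP (a =P 0)) => [->|/F2_neq0->]; first by rewrite add0r mul1r.
case: (altP (b =P 0)) => [->|/F2_neq0->]; first by rewrite addr0 mulr1.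
by rewrite F2_addrr eqxx.
Qed.

Lemma sgn2_sqr a : sgn2 a * sgn2 a = 1.
Proof. by rewrite -sgn2D F2_addrr. Qed.

Variable T : finZmodType.

(** Translating the summation variable by [x0] negates every term, so the sum equals its own
    opposite. *)
Lemma sum_sgn2_additive (h : T -> 'F_2) x0 :
  {morph h : x y / x + y} -> h x0 != 0 -> \sum_x sgn2 (h x) = 0.
Proof.
move=> hD hx0; apply/eqP; rewrite -Num.Theory.eqNr.
rewrite {2}(reindex_inj (addIr x0)) /= -sumrN; apply/eqP/eq_bigr => x _.
by rewrite hD sgn2D (F2_neq0 hx0) mulrN1.
Qed.

(* The square of the sum is #|T|: in \sum_y \sum_x sgn2 (f x + f (x + y)) only
   y = 0 contributes. *)
Lemma sum_sgn2_bent (f : T -> 'F_2) :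
  (forall y, {morph (fun x => f (x + y) - f x - f y) : x z / x + z}) ->
  (forall y, y != 0 -> exists x, f (x + y) - f x - f y != 0) ->
  \sum_x sgn2 (f x) != 0.
Proof.
move=> fD f_nondeg.
suff : (\sum_x sgn2 (f x)) * (\sum_x sgn2 (f x)) = #|T|%:R.
  apply: contra_eq_neq => ->; rewrite mul0r eq_sym Num.Theory.pnatr_eq0 -lt0n.
  by apply/card_gt0P; exists 0.
rewrite mulr_suml.
rewrite (eq_bigr (fun x => \sum_y sgn2 (f x) * sgn2 (f (x + y)))); last first.
  move=> x _; rewrite mulr_sumr (reindex_inj (addrI x)); exact: eq_bigr.
rewrite exchange_big /= (bigD1 0) //= [X in _ + X]big1 => [|y y0].
  rewrite addr0 (eq_bigr (fun=> 1)) ?sumr_const // => x _.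
  by rewrite addr0 sgn2_sqr.
have [x0 fx0] := f_nondeg y y0.
(* Over F_2, [f x + f (x + y)] is the polar form plus the constant [f y]; the polar form is additive
   and nonzero in [x], so its character sum vanishes. *)
rewrite (eq_bigr (fun x => sgn2 (f (x + y) - f x - f y) * sgn2 (f y))).
  by rewrite -mulr_suml (sum_sgn2_additive (fD y) fx0) mul0r.
by move=> x _; rewrite -!sgn2D subrK F2_oppr addrC.
Qed.

End SignSums.

(** * The codes C^(i) *)

Section LinearCombination.

Variables (N : nat) (V : vectType 'F_2) (a : 'I_N -> V).

(** The syndrome of [w] for the check matrix with columns [a k]. *)
Definition lincomb (w : 'rV['F_2]_N) : V := \sum_k w 0 k *: a k.

Lemma lincomb_is_linear : linear lincomb.
Proof.
move=> c v w; rewrite /lincomb scaler_sumr -big_split /=.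
by apply: eq_bigr => k _; rewrite !mxE scalerDl scalerA.
Qed.
HB.instance Definition _ :=
  GRing.isLinear.Build 'F_2 'rV['F_2]_N V _ lincomb lincomb_is_linear.

Lemma lincomb_delta k : lincomb (delta_mx 0 k) = a k.
Proof.
rewrite /lincomb (bigD1 k) //= mxE !eqxx scale1r big1 ?addr0 // => j jk.
by rewrite mxE (negbTE jk) andbF scale0r.
Qed.

Lemma lincomb_permv w (s : 'S_N) :
  lincomb (permv w s) = \sum_k w 0 k *: a (s k).
Proof.
rewrite /lincomb (reindex_inj (@perm_inj _ s)) /=.
by apply: eq_bigr => k _; rewrite mxE permK.
Qed.

End LinearCombination.

(** A linear map vanishing on the kernel of another factors through it; here [phi] is the second map
    after a section of the first on its image. *)
Lemma lincomb_factor N (V W : vectType 'F_2) (a : 'I_N -> V) (a' : 'I_N -> W) :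
  (forall w, lincomb a w = 0 -> lincomb a' w = 0) ->
  exists phi : 'Hom(V, W), forall k, a' k = phi (a k).
Proof.
move=> ker_a; pose f := linfun (lincomb a); pose e := linfun (lincomb a').
have fK w : lincomb a (f^-1%VF (lincomb a w)) = lincomb a w.
  have := @limg_lfunVK _ _ _ f (f w); rewrite memv_img ?memvf // => /(_ isT).
  by rewrite !lfunE.
exists (e \o f^-1)%VF => k; rewrite comp_lfunE lfunE /=.
rewrite -(lincomb_delta a k) -(lincomb_delta a' k).
by apply/eqP; rewrite -subr_eq0 -raddfB; apply/eqP/ker_a; rewrite raddfB /= fK subrr.
Qed.

Section Construction.

Variables (u m n r : nat) (hu : (1 <= u)%N) (hm : m = (2 * u)%N).
Hypotheses (hn : n = (2 ^ m - 1)%N) (hr : r = (2 ^ u + 1)%N).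
Variables (F : fieldExtType 'F_2) (alpha : F).
Hypothesis hF : \dim {:F} = m.
Hypothesis halpha : n.-primitive_root alpha.
Variables (b : m.-tuple F) (hb : basis_of {:F} b).

Local Notation q := (2 ^ u)%N.
Local Notation p := (@coord_point n F alpha).

Let pchar2F : 2%N \in [pchar F].
Proof. by rewrite pchar_lalg pchar_Fp. Qed.

Lemma frobD (x y : F) : (x + y) ^+ q = x ^+ q + y ^+ q.
Proof. by rewrite exprDn_pchar // (eq_pnat _ (pcharf_eq pchar2F)) pnatX pnat_id. Qed.

Lemma frobZ (c : 'F_2) (x : F) : (c *: x) ^+ q = c *: x ^+ q.
Proof.
rewrite exprZn; congr (_ *: _).
case: (altP (c =P 0)) => [->|/F2_neq0->]; last by rewrite expr1n.
by rewrite expr0n expn_eq0.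
Qed.

Lemma lincomb_frob N (a : 'I_N -> F) w :
  lincomb (fun k => a k ^+ q) w = lincomb a w ^+ q.
Proof.
rewrite /lincomb; symmetry; apply: (big_rec2 (fun x y => x ^+ q = y)).
  by rewrite expr0n expn_eq0.
by move=> k x _ _ <-; rewrite frobD frobZ.
Qed.

Lemma frobK (x : F) : (x ^+ q) ^+ q = x.
Proof.
have := memvf x; rewrite (Fermat's_little_theorem (aspacef F)) card_Fp //=.
by rewrite hF hm mul2n -addnn expnD exprM => /eqP.
Qed.

Lemma card_n : n.+1 = (2 ^ m)%N.
Proof. by rewrite hn subn1 prednK ?expn_gt0. Qed.

(** This is the trace of [alpha] to the subfield of order q. If it vanished, [alpha ^+ q] would
    equal [alpha], impossible for a primitive root of order n as 1 < q < n. *)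
Lemma trace_alpha_neq0 : alpha + alpha ^+ q != 0.
Proof.
have q2 : (2 <= q)%N by rewrite -{1}(expn1 2) leq_exp2l.
have qn : (q < n)%N.
  rewrite -ltnS card_n hm mul2n -addnn expnD.
  apply: leq_trans (_ : q * 2 <= _)%N; rewrite ?leq_mul2l ?q2 ?orbT //.
  by rewrite muln2 -addnn -addn2 leq_add2l.
rewrite -[alpha ^+ q](oppr_pchar2 pchar2F) subr_eq0 -{1}(expr1 alpha).
rewrite (eq_prim_root_expr halpha) !modn_small //; last exact: ltn_trans qn.
by rewrite neq_ltn q2.
Qed.

Lemma alpha_exp_neq0 j : alpha ^+ j != 0.
Proof.
rewrite expf_neq0 //; apply/eqP=> a0; have := prim_expr_order halpha.
by rewrite a0 expr0n gtn_eqF ?(prim_order_gt0 halpha) // => /esym/eqP; rewrite oner_eq0.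
Qed.

Lemma coord_point0 : p ord0 = 0.
Proof. by rewrite /coord_point unlift_none. Qed.

Lemma coord_pointS j : p (lift ord0 j) = alpha ^+ j.
Proof. by rewrite /coord_point liftK. Qed.

Lemma coord_point_inj : injective p.
Proof.
move=> k l; case: (unliftP ord0 k) => [j|] ->; case: (unliftP ord0 l) => [i|] ->.
- rewrite !coord_pointS => /eqP; rewrite (eq_prim_root_expr halpha).
  by rewrite !modn_small // => /eqP/val_inj->.
- by rewrite coord_pointS coord_point0 => /eqP; rewrite (negbTE (alpha_exp_neq0 _)).
- by rewrite coord_pointS coord_point0 => /esym/eqP; rewrite (negbTE (alpha_exp_neq0 _)).
- by [].
Qed.

Lemma coord_point_surj x : exists k, p k = x.
Proof.
have cF : #|finvect_type F| = n.+1.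
  rewrite -(card_vspacef (Vector.on (finvect_type F))) card_vspace card_Fp //.
  by rewrite card_n -hF.
have /codomP[k ->] : (x : finvect_type F) \in codom (p : 'I_n.+1 -> finvect_type F).
  by apply: inj_card_onto => //; [exact: coord_point_inj | rewrite cF card_ord].
by exists k.
Qed.

Lemma mulmx_coord_eq0 (a : 'I_n -> F) (v : 'rV['F_2]_n) :
  ((\matrix_(k < m, j < n) coord b k (a j)) *m v^T == 0) = (lincomb a v == 0).
Proof.
have E k : ((\matrix_(k < m, j < n) coord b k (a j)) *m v^T) k 0
           = coord b k (lincomb a v).
  rewrite mxE raddf_sum; apply: eq_bigr => j _.
  by rewrite !mxE [RHS]scalarZ mulrC.
apply/eqP/eqP => [M0|L0]; last by apply/colP=> k; rewrite E L0 raddf0 mxE.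
rewrite (coord_basis hb (memvf (lincomb a v))) big1 // => k _.
by rewrite -E M0 mxE scale0r.
Qed.

Lemma mem_code_u v : (v \in code_u n b alpha r) =
  (lincomb (fun j : 'I_n => alpha ^+ j) v == 0) &&
  (lincomb (fun j : 'I_n => (alpha ^+ j) ^+ r) v == 0).
Proof.
rewrite /code_u memv_cap; congr (_ && _).
  exact: etrans (mem_check_code _ v) (mulmx_coord_eq0 (fun j => alpha ^+ j) v).
rewrite (etrans (mem_check_code _ v) (mulmx_coord_eq0 (fun j => alpha ^+ (j * r)) v)).
by congr (_ == 0); apply: eq_bigr => j _; rewrite exprM.
Qed.

(** * Codes lying between $C^{(u)}$ and the code with check matrix $H_m$ *)

Variable C : {vspace 'rV['F_2]_n}.
Implicit Type w : 'rV['F_2]_n.+1.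
Hypothesis leC : (code_u n b alpha r <= C)%VS.
Hypothesis Cle : (C <= check_code (Hmx n b alpha))%VS.

Local Notation Cx := (extended_code C).

Lemma lincomb_ext (a : 'I_n.+1 -> F) w : a ord0 = 0 ->
  lincomb a w = lincomb (fun j => a (lift ord0 j)) (ext_tail w).
Proof.
move=> a0; rewrite /lincomb big_ord_recl a0 scaler0 add0r.
by apply: eq_bigr => j _; rewrite mxE.
Qed.

Lemma ext_code_checks w :
  w \in Cx -> \sum_k w 0 k = 0 /\ lincomb p w = 0.
Proof.
rewrite mem_extended_code => /andP[/eqP w0 /(subvP Cle)].
rewrite mem_check_code (mulmx_coord_eq0 (fun j => alpha ^+ j)) => /eqP wH; split=> //.
rewrite lincomb_ext ?coord_point0 // -[RHS]wH.
by apply: eq_bigr => j _; rewrite coord_pointS.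
Qed.

Lemma checks_ext_code w :
  \sum_k w 0 k = 0 -> lincomb p w = 0 -> lincomb (fun k => p k ^+ r) w = 0 ->
  w \in Cx.
Proof.
move=> w0 w1 w2; rewrite mem_extended_code w0 eqxx (subvP leC) // mem_code_u.
apply/andP; split; apply/eqP.
  rewrite -[RHS]w1 lincomb_ext ?coord_point0 //.
  by apply: eq_bigr => j _; rewrite coord_pointS.
rewrite -[RHS]w2 lincomb_ext ?coord_point0 ?expr0n ?hr ?addn1 //.
by apply: eq_bigr => j _; rewrite coord_pointS.
Qed.

Lemma translationsP (t : 'S_n.+1) :
  reflect (exists x, forall k, p (t k) = p k + x) (t \in translations n alpha).
Proof.
rewrite inE; apply: (iffP existsP) => [[x /forallP tx]|[x tx]]; exists x.
  by move=> k; apply/eqP.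
by apply/forallP=> k; apply/eqP.
Qed.

Lemma translation_exists x : exists t : 'S_n.+1, forall k, p (t k) = p k + x.
Proof.
have [f fE] := fin_all_exists (fun k => coord_point_surj (p k + x)).
have f_inj : injective f.
  by move=> k l /(congr1 p); rewrite !fE => /addIr/coord_point_inj.
by exists (perm f_inj) => k; rewrite permE.
Qed.

Lemma normD (x y : F) :
  (x + y) ^+ r = x ^+ r + y ^+ r + (x ^+ q * y + x * y ^+ q).
Proof.
rewrite hr !exprD !expr1 frobD mulrDl !mulrDr -!addrA; congr (_ + _).
by rewrite [x * _]mulrC addrA [RHS]addrC.
Qed.

Lemma norm_polar (x y : F) :
  (x + y) ^+ r - x ^+ r - y ^+ r = x ^+ q * y + x * y ^+ q.
Proof. by rewrite normD -[LHS]addrA -opprD [LHS]addrC addKr. Qed.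

Lemma translations_Aut : translations n alpha \subset Aut_code Cx.
Proof.
apply/subsetP=> t /translationsP[x tx]; apply/mem_Aut_code=> w wC.
have [w0 w1] := ext_code_checks wC.
(* A codeword [w] is known to satisfy only two of the three checks, whereas the difference
   [permv w t - w] satisfies all three and so lies in the code. *)
rewrite -[permv w t](subrK w) rpredD //; apply: checks_ext_code.
- rewrite (eq_bigr (fun k => permv w t 0 k - w 0 k)); last by move=> k _; rewrite !mxE.
  by rewrite sumrB sum_permv subrr.
- rewrite raddfB /= lincomb_permv w1 subr0.
  rewrite (eq_bigr (fun k => w 0 k *: p k + w 0 k *: x)); last first.
    by move=> k _; rewrite tx scalerDr.
  by rewrite big_split /= -scaler_suml w0 scale0r addr0.
- rewrite raddfB /= lincomb_permv /lincomb -sumrB.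
  rewrite (eq_bigr (fun k => w 0 k *: x ^+ r + ((w 0 k *: p k ^+ q) * x +
    (w 0 k *: p k) * x ^+ q))); last first.
    move=> k _; rewrite tx normD -scalerBr -!scalerAl -!scalerDr; congr (_ *: _).
    by rewrite -[p k ^+ r + _ + _]addrA addrC addrK.
  rewrite big_split /= -scaler_suml w0 scale0r add0r big_split /= -!mulr_suml.
  rewrite -!/(lincomb _ _) lincomb_frob w1 mul0r addr0.
  by rewrite expr0n expn_eq0 mul0r.
Qed.

(** Norms lie in the subfield of order q, as [frobK] makes Frobenius swap the factors [x] and
    [x ^+ q]. *)
Lemma norm_frob (x : F) : (x ^+ r) ^+ q = x ^+ r.
Proof. by rewrite hr exprD expr1 exprMn frobK mulrC. Qed.

(** * Automorphisms fixing the parity coordinate *)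

Section Stabilizer.

Variable s : 'S_n.+1.
Hypotheses (sC : s \in Aut_code Cx) (s0 : s ord0 = ord0).

Lemma stab_quadratic : exists phi : 'Hom((F * F * ('F_2)^o)%type, F),
  forall k, p (s k) = phi (p k, p k ^+ r, 0).
Proof.
(* The syndrome for [a] collects all three checks; the constant 1 carries the overall parity. Its
   vanishing puts [w], hence its image under [s], in the code. *)
pose a k : (F * F * ('F_2)^o)%type := (p k, p k ^+ r, 1).
have [w aw0|phi phiE] := @lincomb_factor _ _ _ a (fun k => p (s k)).
  have a1 : lincomb p w = (lincomb a w).1.1 by rewrite /lincomb !raddf_sum.
  have a2 : lincomb (fun k => p k ^+ r) w = (lincomb a w).1.2.
    by rewrite /lincomb !raddf_sum.
  have a3 : \sum_k w 0 k = (lincomb a w).2.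
    by rewrite /lincomb !raddf_sum; apply: eq_bigr => k _; rewrite /= [RHS]mulr1.
  have wC : w \in Cx by apply: checks_ext_code; rewrite ?a1 ?a2 ?a3 aw0.
  have /mem_Aut_code/(_ _ wC)/ext_code_checks[_] := sC.
  by rewrite lincomb_permv.
(* The constant term vanishes because [s] fixes the point 0. *)
have phi1 : phi (0, 0, 1) = 0.
  by have := phiE ord0; rewrite s0 /a coord_point0 expr0n hr addn1.
exists phi => k; rewrite phiE -[RHS]addr0 -phi1 -raddfD.
by congr (phi (_, _)); rewrite /= ?addr0 ?add0r.
Qed.

(* A nonzero quadratic part would make some coordinate of the permutation bent,
   whereas coordinates of a bijection are balanced. *)
Lemma stab_additive : exists g : F -> F,
  {morph g : x y / x + y} /\ forall k, p (s k) = g (p k).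
Proof.
have [phi phiE] := stab_quadratic.
pose g x := phi (x, x ^+ r, 0).
have g_inj : injective g.
  move=> x y; have [k <-] := coord_point_surj x; have [l <-] := coord_point_surj y.
  by rewrite /g -!phiE => /coord_point_inj/perm_inj->.
pose mu x := phi (0, x, 0).
have muD : {morph mu : x y / x + y}.
  by move=> x y; rewrite /mu -raddfD; congr (phi (_, _, _)); rewrite /= addr0.
have gD x y : g (x + y) - g x - g y = mu (x ^+ q * y + x * y ^+ q).
  rewrite /g /mu -!raddfB; congr (phi (_, _, _)) => /=.
    by rewrite addrAC addrK subrr.
    exact: norm_polar.
  by rewrite !subr0.
have mu0 x : mu (x ^+ r) = 0.
  apply/eqP; apply: contraT => mux.
  have [i lx] : exists i, coord b i (mu (x ^+ r)) != 0.
    apply/existsP; apply: contraNT mux; rewrite negb_exists => /forallP l0.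
    rewrite (coord_basis hb (memvf (mu _))) big1 // => i _.
    by move/negPn/eqP: (l0 i) => ->; rewrite scale0r.
  have lD : {morph (coord b i : F -> 'F_2) : y z / y + z} by exact: raddfD.
  pose f y := coord b i (g y).
  have fE y z : f (y + z) - f y - f z = coord b i (mu (y ^+ q * z + y * z ^+ q)).
    by rewrite -gD !raddfB.
  have fD z : {morph (fun y => f (y + z) - f y - f z) : y y' / y + y'}.
    move=> y y'; rewrite !fE -lD -muD; congr (coord b i (mu _)).
    by rewrite frobD !mulrDl addrACA.
  have f_nondeg y : y != 0 -> exists z, f (z + y) - f z - f y != 0.
    move=> y0; pose t := alpha + alpha ^+ q.
    have tq : t ^+ q = t by rewrite frobD frobK addrC.
    (* With c = x^r / t in the subfield of order q, this z = c alpha / y^q gives z^q y = c alpha^q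
       and z y^q = c alpha, whose sum is c t = x^r; [mu] was assumed nonzero there. *)
    exists ((x ^+ r / t) * alpha / y ^+ q); rewrite fE.
    rewrite !exprMn !exprVn frobK norm_frob tq.
    rewrite mulfVK // mulfVK ?expf_neq0 //.
    by rewrite -mulrDr addrC divfK // trace_alpha_neq0.
  have := @sum_sgn2_bent (finvect_type F) f fD f_nondeg.
  (* Reindexing by the bijection [g] turns the bent sum into the character sum of a nonzero linear
     coordinate, which is 0. *)
  rewrite -(reindex_inj (g_inj : @injective (finvect_type F) (finvect_type F) g)
      (P := xpredT) (F := fun y : finvect_type F => sgn2 (coord b i y))) /=.
  by rewrite (@sum_sgn2_additive (finvect_type F) (coord b i) _ lD lx) eqxx.
exists g; split=> // x y; have := gD x y.
have muB z t : mu (z - t) = mu z - mu t.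
  by apply/eqP; rewrite eq_sym subr_eq -muD subrK.
(* The polar form is a combination of norms, so [mu] kills it and the defect of additivity of [g] is
   0. *)
by rewrite -norm_polar !muB !mu0 !subr0 -addrA -opprD => /eqP; rewrite subr_eq0 => /eqP.
Qed.

End Stabilizer.

(** * The translation group and the semidirect product *)

Lemma translations_group_set : group_set (translations n alpha).
Proof.
apply/group_setP; split.
  by apply/translationsP; exists 0 => k; rewrite perm1 addr0.
move=> t t' /translationsP[x tx] /translationsP[y ty]; apply/translationsP.
by exists (x + y) => k; rewrite permM ty tx addrA.
Qed.

Let T := Group translations_group_set.

Lemma translations_isog : translations n alpha \isog [set: 'rV['F_2]_m].
Proof.
(* A translation is determined by the image of 0, read here in the basis [b]. *)
pose f (t : 'S_n.+1) : 'rV['F_2]_m := \row_i coord b i (p (t ord0)).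
have trE t k : t \in T -> p (t k) = p k + p (t ord0).
  by case/translationsP=> x tx; rewrite !tx coord_point0 add0r.
have fM : {in T &, {morph f : t t' / (t * t')%g >-> (t * t')%g}}.
  move=> t t' tT t'T; apply/rowP=> i; rewrite !mxE permM trE //.
  exact: raddfD.
have f_inj : {in T &, injective f}.
  move=> t t' tT t'T /rowP ftt; apply/permP=> k; apply: coord_point_inj.
  rewrite (trE t k) // (trE t' k) //; congr (_ + _).
  rewrite (coord_basis hb (memvf (p (t ord0)))).
  rewrite (coord_basis hb (memvf (p (t' ord0)))).
  by apply: eq_bigr => i _; have := ftt i; rewrite !mxE => ->.
have fMT : morphic T f by apply/morphicP.
apply: (@misom_isog _ _ _ _ f); apply/misomP; exists fMT.
apply/(@isomP _ _ T [set: 'rV['F_2]_m]%G); split.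
  by apply/injmP=> t t' tT t'T; apply: f_inj.
apply/setP=> v; rewrite inE; apply/imsetP.
have [t tx] := translation_exists (\sum_i v 0 i *: b`_i).
have tT : t \in T by apply/translationsP; exists (\sum_i v 0 i *: b`_i).
exists t; first by rewrite inE tT.
apply/rowP=> i; rewrite mxE tx coord_point0 add0r coord_sum_free //.
exact: basis_free hb.
Qed.

Lemma translations_transitive k :
  exists2 t, t \in translations n alpha & t k = ord0.
Proof.
have [t tx] := translation_exists (- p k); exists t.
  by apply/translationsP; exists (- p k).
by apply: coord_point_inj; rewrite tx subrr coord_point0.
Qed.

Lemma sdprod_translations :
  (translations n alpha ><| 'C_(Aut_code Cx)[ord0 | 'P])%g = Aut_code Cx.
Proof.
have TA : T \subset Aut_code Cx := translations_Aut.
have nT : 'C_(Aut_code Cx)[ord0 | 'P]%g \subset 'N(T)%g.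
  apply/subsetP=> s; rewrite in_setI => /andP[sC /astab1P s0].
  have [g [gD gE]] := stab_additive sC s0.
  (* Conjugating translation by [x] with the additive map [g] yields translation by [g x]. *)
  rewrite inE; apply/subsetP=> _ /imsetP[t /translationsP[x tx] ->].
  apply/translationsP; exists (g x) => k.
  by rewrite conjgE !permM gE tx gD -gE permKV.
have TI : (T :&: 'C_(Aut_code Cx)[ord0 | 'P])%g = 1%g.
  apply/trivgP/subsetP=> t; rewrite 2!in_setI => /and3P[/translationsP[x tx] _].
  move=> /astab1P t0; rewrite inE; apply/eqP/permP=> k; rewrite perm1.
  apply: coord_point_inj; rewrite tx; have := tx ord0.
  have -> : t ord0 = ord0 by [].
  by rewrite coord_point0 add0r => <-; rewrite addr0.
rewrite -[translations n alpha]/(gval T).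
rewrite (@sdprodE _ T ('C_(Aut_code Cx)[ord0 | 'P])%G nT TI).
apply/eqP; rewrite eqEsubset mul_subG ?subsetIl //=; apply/subsetP=> s sC.
(* The translation [t] agrees with [s] at the preimage of [ord0], so [t^-1 * s] fixes [ord0] and [s]
   factors as [t] times a stabilizer element. *)
have [t tT ts] := translations_transitive (s^-1%g ord0).
have tC : t \in Aut_code Cx by exact: (subsetP TA).
rewrite -(mulKVg t s) mem_mulg // in_setI groupM ?groupV //=.
apply/astab1P; rewrite /= /aperm permM; have -> : t^-1%g ord0 = s^-1%g ord0.
  exact: canLR (permK t) (esym ts).
by rewrite permKV.
Qed.

End Construction.

Theorem theorem2 (u m n r : nat) (hu : (1 <= u)%N) (hm : m = (2 * u)%N)
  (hn : n = (2 ^ m - 1)%N) (hr : r = (2 ^ u + 1)%N)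
  (F : fieldExtType 'F_2) (hF : \dim {:F} = m)
  (K : {subfield F}) (hK : \dim K = u)
  (alpha : F) (halpha : n.-primitive_root alpha)
  (g1 g2 : 'I_n -> F)
  (hg1 : forall j, g1 j \in K) (hg2 : forall j, g2 j \in K)
  (hg : forall j : 'I_n, alpha ^+ j = g1 j + g2 j * alpha)
  (b : m.-tuple F) (hb : basis_of {:F} b)
  (i : nat) (hi : (i <= u)%N)
  (vs : (u - i).-tuple 'rV['F_2]_n)
  (hvs : forall k, Hmx n b alpha *m (tnth vs k)^T = 0)
  (hS : free [seq Ssum g1 g2 v | v <- vs]) :
  let C := code_gen b alpha r vs in
  let Cx := extended_code C in
  let Stab := ('C_(Aut_code Cx)[ord0 | 'P])%g in
  [/\ translations n alpha \isog [set: 'rV['F_2]_m],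
      misom (Aut_code C) Stab (lift_perm ord0 ord0),
      (translations n alpha ><| Stab)%g = Aut_code Cx
    & completely_transitive C -> completely_transitive Cx].
Proof.
move=> C Cx Stab.
have leC : (code_u n b alpha r <= C)%VS by apply: addvSl.
have Cle : (C <= check_code (Hmx n b alpha))%VS.
  (* Both summands satisfy the [Hmx] check: [code_u] by definition, the added generators by
     [hvs]. *)
  rewrite subv_add capvSl /=; apply/span_subvP=> _ /tnthP[k ->].
  by rewrite mem_check_code hvs.
have TA : translations n alpha \subset Aut_code Cx.
  exact: (translations_Aut hr hb leC Cle).
split.
- exact: (translations_isog hn hF halpha hb).
- exact: misom_lift_perm.
- exact: (sdprod_translations hu hm hn hr hF halpha hb leC Cle).
- apply: completely_transitive_ext => k.
  have [t tT tk] := translations_transitive hn hF halpha k.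
  by exists t; rewrite // (subsetP TA).
Qed.
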